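(* Suppose $\alpha=\alpha_n\to0$ as $n\to\infty$. Then for every $g\in C_w^k[0,\infty)$, $$\lim_{n\to\infty}\|\mathcal{RL}_{n}^{[\alpha]}g-g\|_w=0.$$
   Context: Standing data: $(\beta_n)_{n\in\mathbb N}$ is a strictly increasing sequence of real numbers with $\beta_1=1$ and $\beta_n\to\infty$; $\phi,\psi$ are fixed reals with $0\le\phi\le\psi$; $\alpha=\alpha_n\ge 0$ is a sequence of nonnegative reals (the index $n$ is suppressed). For $i\ge1$ put $x^{(i,-\alpha)}=\prod_{j=1}^{i}(x+(j-1)\alpha)$, and $x^{(0,-\alpha)}=1$. For $x\ge0$ and locally integrable $g$ on $[0,\infty)$ for which the series converges absolutely (in particular for $g$ of at most polynomial growth) define $$\mathcal{RL}_{n}^{[\alpha]}(g;x)=\beta_n\sum_{i=0}^{\infty}(1+\beta_n\alpha)^{-x/\alpha}\left(\alpha+\frac{1}{\beta_n}\right)^{-i}\frac{x^{(i,-\alpha)}}{i!}\int_{i/\beta_n}^{(i+1)/\beta_n}g\left(\frac{\beta_n t+\phi}{\beta_n+\psi}\right)dt,$$ where for $\alpha=0$ the factor $(1+\beta_n\alpha)^{-x/\alpha}$ is read as its limit $e^{-\beta_n x}$; $\mathcal{RL}_{n}^{[\alpha]}g$ denotes the function $x\mapsto\mathcal{RL}_{n}^{[\alpha]}(g;x)$. Let $w(x)=1+x^2$. $B_w[0,\infty)$ is the set of $g:[0,\infty)\to\mathbb{R}$ with $|g(x)|\le Mw(x)$ for some constant $M>0$, normed by $\|g\|_w=\sup_{x\ge0}|g(x)|/w(x)$;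 $C_w[0,\infty)$ is the set of continuous $g\in B_w[0,\infty)$; and $C_w^k[0,\infty)$ is the set of $g\in C_w[0,\infty)$ such that $\lim_{x\to\infty}|g(x)|/w(x)=k_g$ exists and is finite ($k$ is only a label). *)

(* Defs.v *)
From mathcomp Require Import all_boot all_order all_algebra.
From mathcomp Require Import all_classical all_reals all_analysis.

Set Implicit Arguments.
Unset Strict Implicit.
Unset Printing Implicit Defensive.

Import Order.TTheory GRing.Theory Num.Theory.
Import numFieldNormedType.Exports.

Local Open Scope classical_set_scope.
Local Open Scope ring_scope.

(* Functions on [0, +oo[ are represented by functions g : R -> R of which only
   the values on [0, +oo[ are used. *)

(* x^{(i, -a)} = x (x + a) (x + 2 a) ... (x + (i - 1) a) *)
Definition rising (R : realType) (a x : R) (i : nat) : R :=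
  \prod_(j < i) (x + j%:R * a).

(* (1 + b a)^{-x/a}; as x / 0 = 0, the limit value at a = 0 has to be given
   separately. *)
Definition rl_factor (R : realType) (b a x : R) : R :=
  if a == 0 then expR (- (b * x)) else (1 + b * a) `^ (- (x / a)).

Definition rl_term (R : realType) (b a phi psi : R) (g : R -> R) (x : R)
    (i : nat) : R :=
  rl_factor b a x * (a + b^-1) ^- i * (rising a x i / i`!%:R) *
  \int[lebesgue_measure]_(t in `[i%:R / b, i.+1%:R / b])
    g ((b * t + phi) / (b + psi)).

(* RL_n^{[alpha]} is RL (beta n) (alpha n) phi psi. The limit of the partial
   sums is meaningful whenever the series converges, in particular, for
   0 <= a, 0 < b, 0 <= phi, 0 <= psi and 0 <= x, when g is continuous of
   polynomial growth. *)
Definition RL (R : realType) (b a phi psi : R) (g : R -> R) (x : R) : R :=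
  b * limn (series (rl_term b a phi psi g x)).

Definition weight (R : realType) (x : R) : R := 1 + x ^+ 2.

Definition Bw (R : realType) : set (R -> R) :=
  [set g | exists2 M : R, 0 < M &
             forall x : R, 0 <= x -> `|g x| <= M * weight x].

Definition Cw (R : realType) : set (R -> R) :=
  [set g | @Bw R g /\ {within `[0, +oo[, continuous g}].

Definition Cwk (R : realType) : set (R -> R) :=
  [set g | @Cw R g /\
           exists k : R, `|g x| / weight x @[x --> +oo] --> k].

(* Extended-real valued: finite exactly on Bw, so that no boundedness is
   needed to give it its meaning. *)
Definition wnorm (R : realType) (g : R -> R) : \bar R :=
  ereal_sup [set (`|g x| / weight x)%:E | x in `[0, +oo[].

(* Main.v *)
Require Import Defs.
From mathcomp Require Import all_boot all_order all_algebra.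
From mathcomp Require Import all_classical all_reals all_analysis.
From mathcomp Require Import ring lra.

Set Implicit Arguments.
Unset Strict Implicit.
Unset Printing Implicit Defensive.

Import Order.TTheory GRing.Theory Num.Theory.
Import numFieldNormedType.Exports.

Local Open Scope classical_set_scope.
Local Open Scope ring_scope.

(** The weights of [RL] are a negative binomial law (a Poisson law for
    [alpha = 0]) in the index [i], for which [i / beta] has mean [x] and
    variance [x * alpha + x / beta].  A function [g] of [Cwk] is asymptotic to
    [c * weight] for a constant [c], because [g] has constant sign near
    infinity when the limit of [|g| / weight] is not zero; combined with
    uniform continuity on segments this gives
    [|g u - g x| <= e * weight x + C * (u - x) ^+ 2] for all [x, u >= 0].
    Averaging this inequality against the weights bounds [|RL g x - g x|] by
    [e * weight x] plus [C * weight x] times a quantity tending to 0,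
    uniformly in [x]. *)

(** * Rising factorials and the generalised binomial series *)

(* The coefficients of the power series of y |-> (1 - a y)^(-x/a). *)
Definition rcoef (R : realType) (a x : R) (i : nat) : R := rising a x i / i`!%:R.

Lemma risingS (R : realType) (a x : R) i :
  rising a x i.+1 = x * rising a (x + a) i.
Proof.
rewrite /rising big_ord_recl mul0r addr0; congr (_ * _).
by apply: eq_bigr => j _; rewrite lift0 -addn1 natrD; ring.
Qed.

Lemma risingSr (R : realType) (a x : R) i :
  rising a x i.+1 = rising a x i * (x + i%:R * a).
Proof. by rewrite /rising big_ord_recr. Qed.

Lemma rcoef0 (R : realType) (a x : R) : rcoef a x 0 = 1.
Proof. by rewrite /rcoef /rising big_ord0 fact0 divr1. Qed.

Lemma rcoefS (R : realType) (a x : R) i :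
  i.+1%:R * rcoef a x i.+1 = x * rcoef a (x + a) i.
Proof.
rewrite /rcoef risingS factS natrM.
rewrite invfM [_ * (_^-1 * _)]mulrCA mulVKf ?pnatr_eq0 // -?mulrA; ring.
Qed.

Lemma rcoefSr (R : realType) (a x : R) i :
  i.+1%:R * rcoef a x i.+1 = (x + i%:R * a) * rcoef a x i.
Proof.
rewrite /rcoef risingSr factS natrM.
rewrite invfM [_ * (_^-1 * _)]mulrCA mulVKf ?pnatr_eq0 // -?mulrA; ring.
Qed.

Lemma rcoef_ge0 (R : realType) (a x : R) i : 0 <= a -> 0 <= x -> 0 <= rcoef a x i.
Proof.
move=> a0 x0; rewrite divr_ge0 // /rising prodr_ge0 // => j _.
by rewrite addr_ge0 // mulr_ge0.
Qed.

Lemma ratio_test (R : realType) (u : R ^nat) (r : R) (N : nat) :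
  0 <= r < 1 -> (forall i, 0 <= u i) ->
  (forall i, (N <= i)%N -> u i.+1 <= r * u i) -> cvgn (series u).
Proof.
move=> /andP[r0 r1] u0 ur.
have le k : u (N + k)%N <= u N * r ^+ k.
  elim: k => [|k IH]; first by rewrite addn0 expr0 mulr1.
  rewrite addnS (le_trans (ur _ (leq_addr _ _))) //.
  by rewrite exprS mulrCA ler_wpM2l.
rewrite -(is_cvg_series_restrict N).
suff : cvgn (series (fun k => u (N + k)%N)).
  move=> /cvg_ex[l ul]; apply/cvg_ex; exists l.
  rewrite -(cvg_shiftn N) (_ : [sequence _]_n = series (fun k => u (N + k)%N)) //.
  apply/funext => n; rewrite seriesEnat /= -{1}[N]add0n big_addn addnK.
  by apply: eq_bigr => i _; rewrite addnC.
apply: (@series_le_cvg _ _ (geometric (u N) r)) => //.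
  by move=> k; rewrite mulr_ge0 // exprn_ge0.
by apply: is_cvg_geometric_series; rewrite ger0_norm.
Qed.

(** By [rcoefSr] the ratio of consecutive terms is [(x + i a) y / (i + 1)], which tends to
    [a y < 1]; the midpoint [r] of [a y] and 1 therefore bounds it for large [i]. *)
Lemma is_cvg_rcoef (R : realType) (a x y : R) : 0 <= a -> 0 <= x -> 0 <= y ->
  a * y < 1 -> cvgn (pseries (rcoef a x) y).
Proof.
move=> a0 x0 y0 ay1; pose r := (1 + a * y) / 2.
have ay0 : 0 <= a * y by rewrite mulr_ge0.
have rP : a * y < r /\ 0 <= r < 1 by rewrite /r; split; [lra|apply/andP; split; lra].
have [ayr r01] := rP.
(* The bound [(x + i a) y <= (i + 1) r] already follows from [y x <= i (r - a y)], hence this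
   threshold. *)
have [N NP] : exists N : nat, y * x / (r - a * y) <= N%:R.
  by exists (Num.truncn (y * x / (r - a * y))).+1; apply/ltW/truncnS_gt.
apply: (@ratio_test _ _ r N) => // [i|i Ni].
  by rewrite mulr_ge0 ?exprn_ge0 ?rcoef_ge0.
have c0 := rcoef_ge0 i a0 x0.
rewrite -(@ler_pM2l _ i.+1%:R) ?ltr0Sn //= exprS.
have -> : i.+1%:R * (rcoef a x i.+1 * (y * y ^+ i)) =
   (i.+1%:R * rcoef a x i.+1) * y * y ^+ i by ring.
rewrite rcoefSr.
have -> : i.+1%:R * (r * (rcoef a x i * y ^+ i)) =
   (i.+1%:R * r) * (rcoef a x i * y ^+ i) by ring.
have -> : (x + i%:R * a) * rcoef a x i * y * y ^+ i =
   ((x + i%:R * a) * y) * (rcoef a x i * y ^+ i) by ring.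
apply: ler_wpM2r; first by rewrite mulr_ge0 ?exprn_ge0.
have : y * x <= i%:R * (r - a * y).
  rewrite -ler_pdivrMr ?subr_gt0 // (le_trans NP) // ler_nat //.
rewrite -natr1; lra.
Qed.

Lemma pseries_diffs_rcoef (R : realType) (a x : R) :
  pseries_diffs (rcoef a x) = x *: rcoef a (x + a).
Proof. by apply/funext => i; rewrite /pseries_diffs rcoefS. Qed.

Lemma pseriesZ (R : realType) (k : R) (f : R ^nat) y :
  pseries (k *: f) y = k *: pseries f y.
Proof.
rewrite /pseries -seriesZ; congr series.
by apply/funext => i; exact/esym/mulrA.
Qed.

(** Compare coefficients: the two recurrences [rcoefS] and [rcoefSr], taken at [x + a], give [rcoef
    a x i.+1 = rcoef a (x + a) i.+1 - a * rcoef a (x + a) i]. This turns the derivative of the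
    series into a multiple of the series itself. *)
Lemma limn_rcoef_shift (R : realType) (a x y : R) :
  0 <= a -> 0 <= x -> 0 <= y -> a * y < 1 ->
  (1 - a * y) * limn (pseries (rcoef a (x + a)) y) = limn (pseries (rcoef a x) y).
Proof.
move=> a0 x0 y0 ay1; apply/esym/cvg_lim => //.
have xa0 : 0 <= x + a by rewrite addr_ge0.
have cv := is_cvg_rcoef a0 xa0 y0 ay1.
rewrite -(cvg_shiftS (pseries (rcoef a x) y)).
have -> : [sequence pseries (rcoef a x) y n.+1]_n =
  (fun n => pseries (rcoef a (x + a)) y n.+1 - a * y * pseries (rcoef a (x + a)) y n).
  apply/funext => n /=; rewrite /pseries /series /= !big_nat_recl //=.
  rewrite !rcoef0 -addrA; congr (_ + _).
  rewrite mulr_sumr -sumrB; apply: eq_bigr => i _.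
  rewrite exprS.
  have h : rcoef a x i.+1 = rcoef a (x + a) i.+1 - a * rcoef a (x + a) i.
    apply: (@mulfI _ i.+1%:R); first by rewrite pnatr_eq0.
    by rewrite mulrBr rcoefS rcoefSr -natr1; ring.
  by rewrite h; ring.
rewrite mulrBl mul1r; apply: cvgB.
  by rewrite (cvg_shiftS (pseries (rcoef a (x + a)) y)).
by apply: cvgM; [exact: cvg_cst|exact: cv].
Qed.

(* The function y |-> (1 - a y)^(x/a) f_x(y), with f_x the sum of the series, has zero
   derivative because f_x' = x f_(x+a) = x f_x / (1 - a y). *)
Lemma limn_rcoef (R : realType) (a x y : R) :
  0 < a -> 0 <= x -> 0 < y -> a * y < 1 ->
  limn (pseries (rcoef a x) y) = (1 - a * y) `^ (- (x / a)).
Proof.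
move=> a_gt0 x0 y0 ay1; have a0 := ltW a_gt0.
pose f t := limn (pseries (rcoef a x) t).
pose e (t : R) : R := expR (x / a * ln (1 - a * t)).
have fD t : 0 <= t -> a * t < 1 ->
    is_derive t 1 f (x * limn (pseries (rcoef a (x + a)) t)).
  (* [K] lies strictly between [t] and the radius [1 / a], so the series and its first two formal
     derivatives converge at [K], as termwise differentiation at [t] requires. *)
  move=> t0 at1; pose K := (t + a^-1) / 2.
  have ai0 : 0 < a^-1 by rewrite invr_gt0.
  have tai : t < a^-1 by rewrite -(ltr_pM2l a_gt0) divff ?gt_eqF.
  have K0 : 0 <= K by rewrite /K; lra.
  have aK : a * K < 1 by rewrite -(divff (lt0r_neq0 a_gt0)) ltr_pM2l // /K; lra.
  have D := @pseries_snd_diffs _ (rcoef a x) K t.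
  have -> : x * limn (pseries (rcoef a (x + a)) t) =
     limn (pseries (pseries_diffs (rcoef a x)) t).
    rewrite pseries_diffs_rcoef pseriesZ limZl_tmp //.
    by apply: is_cvg_rcoef => //; rewrite addr_ge0.
  apply: D.
  - exact: is_cvg_rcoef.
  - rewrite pseries_diffs_rcoef pseriesZ; apply: is_cvgZl_tmp.
    by apply: is_cvg_rcoef => //; rewrite addr_ge0.
  - have -> : pseries_diffs (pseries_diffs (rcoef a x)) =
      x *: ((x + a) *: rcoef a (x + a + a)).
      rewrite pseries_diffs_rcoef -(pseries_diffs_rcoef a (x + a)).
      by apply/funext => i; exact: mulrCA.
    rewrite !pseriesZ; do 2 apply: is_cvgZl_tmp.
    by apply: is_cvg_rcoef => //; rewrite !addr_ge0.
  - by rewrite !ger0_norm // /K; lra.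
have eD t : 0 <= t -> a * t < 1 -> is_derive t 1 e (- x / (1 - a * t) * e t).
  move=> t0 at1; have h : 0 < 1 - a * t by rewrite subr_gt0.
  have hl := is_derive1_ln h.
  apply: is_derive_eq.
  rewrite /e; set E := expR _; rewrite /GRing.scale /=.
  by field; rewrite !gt_eqF.
have GD t : 0 <= t -> a * t < 1 -> is_derive t 1 (e * f) 0.
  move=> t0 at1; have h : 0 < 1 - a * t by rewrite subr_gt0.
  have := fD _ t0 at1; have := eD _ t0 at1 => he hf.
  apply: is_derive_eq; rewrite /f -(limn_rcoef_shift a0 x0 t0 at1) /GRing.scale /=.
  by field; rewrite gt_eqF.
have f0 : f 0 = 1.
  rewrite /f; apply: lim_near_cst => //; near=> n.
  have -> : n = n.-1.+1 by rewrite prednK //; near: n; exists 1%N.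
  rewrite /pseries /series /= big_nat_recl //= rcoef0 mulr1 big1 ?addr0 // => i _.
  by rewrite expr0n mulr0.
have ayP t : t \in `[0, y] -> 0 <= t /\ a * t < 1.
  rewrite in_itv /= => /andP[t0 ty]; split => //.
  by rewrite (le_lt_trans _ ay1) // ler_pM2l.
(* The mean value theorem with zero derivative gives [e y * f y = e 0 * f 0 = 1]. *)
have [||c _] := @MVT _ (e * f) (fun=> 0) 0 y y0.
- by move=> t /subset_itv_oo_cc /ayP[]; exact: GD.
- by apply: derivable_within_continuous => t /ayP[t0 at1]; have [] := GD t t0 at1.
rewrite mul0r => /eqP; rewrite subr_eq0 => /eqP.
rewrite /GRing.mul /= f0 /e mulr0 subr0 ln1 mulr0 expR0 mulr1 => h.
rewrite powRN /powR gt_eqF ?subr_gt0 // -/(e y) -[RHS]mul1r -h mulrC mulKf //.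
by rewrite gt_eqF // expR_gt0.
Unshelve. all: by end_near. Qed.

(** * The weights as a probability law, and their moments *)

(* The weight of the i-th integral in RL, without the leading factor beta. *)
Definition rl_weight (R : realType) (b a x : R) (i : nat) : R :=
  rl_factor b a x * (a + b^-1) ^- i * rcoef a x i.

Lemma rl_factor_ge0 (R : realType) (b a x : R) : 0 <= rl_factor b a x.
Proof. by rewrite /rl_factor; case: ifP => _; rewrite ?expR_ge0 ?powR_ge0. Qed.

Lemma rl_weight_ge0 (R : realType) (b a x : R) i :
  0 < b -> 0 <= a -> 0 <= x -> 0 <= rl_weight b a x i.
Proof.
move=> b0 a0 x0; rewrite mulr_ge0 ?rcoef_ge0 // mulr_ge0 ?rl_factor_ge0 //.
by rewrite invr_ge0 exprn_ge0 // addr_ge0 // invr_ge0 ltW.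
Qed.

Lemma rl_factorD (R : realType) (b a x : R) : 0 < b -> 0 <= a ->
  rl_factor b a x = (1 + b * a) * rl_factor b a (x + a).
Proof.
move=> b0; rewrite /rl_factor; case: eqVneq => [-> _|an0 a0].
  by rewrite mulr0 !addr0 mul1r.
have p : 0 < 1 + b * a by rewrite ltr_pwDl // mulr_ge0 // ltW.
rewrite [(x + a) / a]mulrDl divff // opprD powRD; last by rewrite (gt_eqF p); apply/implyP.
by rewrite powR_inv1 ?ltW // mulrCA divff ?gt_eqF // mulr1.
Qed.

(** The spare factor [(a + 1/b)^-1 = b / (1 + b a)] cancels the [1 + b a] produced by [rl_factorD],
    and [rcoefS] supplies [x]. Each factorial moment at [x] is thereby reduced to one of lower order
    at [x + a]. *)
Lemma rl_weightS (R : realType) (b a x : R) i : 0 < b -> 0 <= a ->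
  i.+1%:R * rl_weight b a x i.+1 = b * x * rl_weight b a (x + a) i.
Proof.
move=> b0 a0; rewrite /rl_weight mulrCA rcoefS rl_factorD // exprS invfM.
have p : 0 < 1 + b * a by rewrite ltr_pwDl // mulr_ge0 // ltW.
have -> : (a + b^-1)^-1 = b / (1 + b * a).
  by rewrite -[b in LHS]invrK; field; rewrite !gt_eqF // addrC.
set c := (_ ^+ _)^-1.
by field; rewrite gt_eqF.
Qed.

(** With [y = (a + 1/b)^-1] one has [(1 + b a) (1 - a y) = 1], so the prefactor is the inverse of
    the binomial series at [y]. For [a = 0] the series is the exponential one. *)
Lemma rl_weight_cvg (R : realType) (b a x : R) : 0 < b -> 0 <= a -> 0 <= x ->
  series (rl_weight b a x) @ \oo --> (1 : R).
Proof.
move=> b0 a0 x0; pose y := (a + b^-1)^-1.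
have bi0 : 0 < b^-1 by rewrite invr_gt0.
have ab0 : 0 < a + b^-1 by rewrite ltr_wpDl.
have y0 : 0 < y by rewrite invr_gt0.
have ay1 : a * y < 1 by rewrite ltr_pdivrMr // mul1r ltrDl.
have -> : series (rl_weight b a x) =
    fun n => rl_factor b a x * pseries (rcoef a x) y n.
  apply/funext => n; rewrite /pseries /series /= mulr_sumr.
  by apply: eq_bigr => i _; rewrite /rl_weight -mulrA exprVn [rcoef _ _ _ * _]mulrC.
suff <- : rl_factor b a x * limn (pseries (rcoef a x) y) = 1.
  by apply: cvgM; [exact: cvg_cst|exact/is_cvg_rcoef/ay1/ltW].
move: a0; rewrite le_eqVlt => /predU1P[a00|a_gt0].
  rewrite /rl_factor -a00 eqxx /y -a00 add0r invrK.
  have -> : pseries (rcoef 0 x) b = series (exp_coeff (b * x)).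
    rewrite /pseries; congr series; apply/funext => i /=.
    rewrite /rcoef /rising (eq_bigr (fun=> x)) => [|j _]; last by rewrite mulr0 addr0.
    by rewrite prodr_const card_ord /exp_coeff /= exprMn mulrAC [b ^+ i * _]mulrC.
  by rewrite -/(expR _) mulrC expRxMexpNx_1.
rewrite limn_rcoef // /rl_factor gt_eqF // -powRM; last 2 first.
- by rewrite addr_ge0 // mulr_ge0 // ltW.
- by rewrite subr_ge0 ltW.
suff -> : (1 + b * a) * (1 - a * y) = 1 by rewrite powR1.
have p : 0 < 1 + b * a by rewrite ltr_pwDl // mulr_ge0 // ltW.
by rewrite /y; field; rewrite !gt_eqF // addrC mulrC.
Qed.

Lemma cvg_series_shift (R : realType) (u v : R ^nat) (k l : R) :
  u 0%N = 0 -> (forall i, u i.+1 = k * v i) ->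
  series v @ \oo --> l -> series u @ \oo --> k * l.
Proof.
move=> u0 uS vl; rewrite -(cvg_shiftS (series u)).
have -> : [sequence series u n.+1]_n = fun n => k * series v n.
  apply/funext => n; rewrite /series /= big_nat_recl //= u0 add0r mulr_sumr.
  by apply: eq_bigr => i _.
by apply: cvgM vl; exact: cvg_cst.
Qed.

Lemma rl_weight_mean (R : realType) (b a x : R) : 0 < b -> 0 <= a -> 0 <= x ->
  series (fun i => i%:R * rl_weight b a x i) @ \oo --> b * x.
Proof.
move=> b0 a0 x0; rewrite -[b * x]mulr1.
apply: (@cvg_series_shift _ _ (rl_weight b a (x + a))).
- by rewrite mul0r.
- by move=> i; exact: rl_weightS.
- by apply: rl_weight_cvg; rewrite // addr_ge0.
Qed.

Lemma rl_weight_mean2 (R : realType) (b a x : R) : 0 < b -> 0 <= a -> 0 <= x ->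
  series (fun i => i%:R * (i%:R - 1) * rl_weight b a x i) @ \oo
    --> b * x * (b * (x + a)).
Proof.
move=> b0 a0 x0.
apply: (@cvg_series_shift _ _ (fun i => i%:R * rl_weight b a (x + a) i)).
- by rewrite !mul0r.
- by move=> i; rewrite mulrAC rl_weightS // -natr1; ring.
- by apply: rl_weight_mean; rewrite // addr_ge0.
Qed.

(** The square is expanded in [i (i - 1)], [i] and 1, whose sums are known; the terms in [x ^+ 2]
    cancel and leave the variance [x a + x / b]. *)
Lemma rl_weight_quad (R : realType) (b a x A B : R) :
  0 < b -> 0 <= a -> 0 <= x ->
  series (fun i => (A + B * (i%:R / b - x) ^+ 2) * rl_weight b a x i) @ \oo
    --> A + B * (x * a + x / b).
Proof.
move=> b0 a0 x0.
have -> : A + B * (x * a + x / b) = B / b ^+ 2 * (b * x * (b * (x + a))) +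
    (B / b ^+ 2 - 2 * B * x / b) * (b * x) + (A + B * x ^+ 2) * 1.
  by field; rewrite gt_eqF.
have -> : series (fun i => (A + B * (i%:R / b - x) ^+ 2) * rl_weight b a x i) =
    fun n => B / b ^+ 2 * series (fun i => i%:R * (i%:R - 1) * rl_weight b a x i) n +
    (B / b ^+ 2 - 2 * B * x / b) * series (fun i => i%:R * rl_weight b a x i) n +
    (A + B * x ^+ 2) * series (rl_weight b a x) n.
  apply/funext => n; rewrite /series /= !mulr_sumr -!big_split /=.
  by apply: eq_bigr => i _; field; rewrite gt_eqF.
apply: cvgD; last by apply: cvgM; [exact: cvg_cst|exact: rl_weight_cvg].
apply: cvgD; apply: cvgM; try exact: cvg_cst.
- exact: rl_weight_mean2.
- exact: rl_weight_mean.
Qed.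

(** * Growth and continuity estimates for functions in [Cwk] *)

Lemma weight_ge1 (R : realType) (x : R) : 1 <= weight x.
Proof. by rewrite /weight lerDl sqr_ge0. Qed.

(** Only [x] is confined to a segment, so Heine's theorem on [[0, T]] does not cover [u > T].
    Continuity at each point of the segment gives the bound for all nearby [x] and all small
    [d > 0]; compactness, in its near-covering form, yields one [d] for the whole segment. *)
Lemma unif_continuous_ray (R : realType) (g : R -> R) (T e : R) :
  {within `[0, +oo[, continuous g} -> 0 < e ->
  exists2 d, 0 < d & forall x u, 0 <= x <= T -> 0 <= u -> `|u - x| < d ->
    `|g u - g x| < e.
Proof.
move=> cg e0.
have cpt := @segment_compact R 0 T.
move/compact_near_coveringP : cpt => /(_ R (0^'+)
  (fun d x => forall u, 0 <= x -> 0 <= u -> `|u - x| < d -> `|g u - g x| < e) _).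
case.
  move=> x /=; rewrite in_itv /= => /andP[x0 _].
  have e20 : 0 < e / 2 by rewrite divr_gt0.
  have := cg; move=> /subspace_continuousP/(_ x).
  rewrite /= in_itv /= x0 => /(_ isT)/cvgrPdist_lt/(_ _ e20).
  rewrite near_withinE => /nbhs_ballP[r /= r0 rP].
  have {}rP y : 0 <= y -> `|y - x| < r -> `|g y - g x| < e / 2.
    move=> y0 yx; rewrite distrC; apply: rP; last by rewrite /= in_itv /= y0.
    by rewrite /ball /= distrC.
  have r20 : 0 < r / 2 by rewrite divr_gt0.
  near=> x' d => u x'0 u0 ux'.
  have x'x : `|x' - x| < r / 2.
    rewrite distrC.
    near: x'. exact: nbhsx_ballx.
  have dr : d <= r / 2 by near: d; exact: nbhs_right_le.
  have h1 := rP _ x'0.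
  have h2 := rP _ u0.
  rewrite (_ : g u - g x' = (g u - g x) - (g x' - g x)); last by ring.
  rewrite (le_lt_trans (ler_normB _ _)) // [ltRHS]splitr ltrD //.
    apply: h2; rewrite (_ : u - x = (u - x') + (x' - x)); last by ring.
    rewrite (le_lt_trans (ler_normD _ _)) // [ltRHS]splitr ltrD //.
    exact: lt_le_trans dr.
  by apply: h1; rewrite (lt_le_trans x'x) // ler_pdivrMr // ler_pMr // ler1n.
move=> d /= d0 dP.
exists (d / 2); first by rewrite divr_gt0.
move=> x u /andP[x0 xT] u0; apply: (dP (d / 2)) => //=.
- rewrite /ball /= sub0r normrN gtr0_norm ?divr_gt0 // ltr_pdivrMr // ltr_pMr //.
  by rewrite ltr1n.
- by rewrite divr_gt0.
- by rewrite in_itv /= x0.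
Unshelve. all: by end_near. Qed.

Lemma Cwk_signed_limit (R : realType) (g : R -> R) : Cwk g ->
  exists c : R, forall e, 0 < e -> exists2 A, 0 <= A &
    forall x, A <= x -> `|g x - c * weight x| <= e * weight x.
Proof.
move=> [[_ cg] [k gk]].
have w0 x : 0 < weight x :> R by rewrite (lt_le_trans ltr01) ?weight_ge1.
have gkP e : 0 < e -> exists2 A, 0 <= A &
    forall x, A <= x -> `| `|g x| - k * weight x| <= e * weight x.
  move=> e0; move/cvgrPdist_le : gk => /(_ _ e0)[A [_ AP]];
  exists (Num.max 0 A + 1); first by rewrite addr_ge0 // le_max lexx.
  move=> x Ax; have /AP : A < x.
    by rewrite (lt_le_trans _ Ax) // ltr_pwDr // le_max lexx orbT.
  rewrite distrC => h; rewrite -ler_pdivrMr // -[X in _ / X](ger0_norm (ltW (w0 x))).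
  rewrite -normrV ?unitfE ?gt_eqF // -normrM mulrBl mulfK ?gt_eqF //.
(* For [k <= 0] the error [|g| - k * weight] is at least [|g|], so [c = 0] works. For [k > 0], [g]
   has no zero beyond some [A0], and the intermediate value theorem fixes its sign there. *)
have [k0|k0] := leP k 0.
  exists (0 : R); move=> e e0; have [A A0 AP] := gkP e e0; exists A => // x /AP.
  rewrite mul0r subr0; apply: le_trans; apply: le_trans (ler_norm _).
  by rewrite lerDl oppr_ge0 mulr_le0_ge0 // ltW.
have k20 : 0 < k / 2 by rewrite divr_gt0.
have [A0 A00 A0P] := gkP _ k20.
have gn0 x : A0 <= x -> g x != 0.
  move=> /A0P; apply: contraTneq => ->; rewrite normr0 sub0r normrN -ltNge.
  rewrite ger0_norm ?mulr_ge0 ?ltW // ltr_pM2r // ltr_pdivrMr // ltr_pMr //.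
  by rewrite ltr1n.
have same x : A0 <= x -> Num.sg (g x) = Num.sg (g A0).
  move=> Ax; apply/eqP; apply: contraT => sne.
  have [||c] := @IVT R g A0 x 0 Ax.
  - apply: continuous_subspaceW cg => z /=; rewrite !in_itv /= => /andP[Az _].
    by rewrite (le_trans A00).
  - move: (gn0 _ (lexx A0)) (gn0 _ Ax) sne.
    case: (ltgtP (g x) 0) => // gx; case: (ltgtP (g A0) 0) => // gA _ _.
    + by rewrite !ltr0_sg // eqxx.
    + by move=> _; rewrite ge_min le_max !(ltW gx) !(ltW gA) ?orbT.
    + by move=> _; rewrite ge_min le_max !(ltW gx) !(ltW gA) ?orbT.
    + by rewrite !gtr0_sg // eqxx.
  by rewrite in_itv /= => /andP[Ac _] /eqP; rewrite (negPf (gn0 c Ac)).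
exists (Num.sg (g A0) * k); move=> e e0; have [A A0' AP] := gkP _ e0.
exists (Num.max A A0); first by rewrite le_max A0'.
move=> x; rewrite ge_max => /andP[/AP Ax A0x].
rewrite -(same x A0x) {1}[g x]numEsg -mulrA -mulrBr normrM normr_sg gn0 // mul1r.
exact: Ax.
Qed.

(** Write [g = c * weight + h] with [h] small relative to [weight] beyond [A]. Uniform continuity
    handles bounded [x] with [u] close to [x]. Otherwise the increment of [c * weight] is bounded
    directly, and [h] is small at both points or [|u - x| >= r], in which case its bound [D] on
    [[0, A]] is absorbed by a multiple of [(u - x) ^+ 2]. *)
Lemma Cwk_modulus (R : realType) (g : R -> R) (e : R) : Cwk g -> 0 < e ->
  exists2 C, 0 <= C & forall x u, 0 <= x -> 0 <= u ->
    `|g u - g x| <= e * weight x + C * (u - x) ^+ 2.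
Proof.
move=> gC e0; have [c cP] := Cwk_signed_limit gC.
have [[[M M0 gM] cg] _] := gC.
have e40 : 0 < e / 4 by rewrite divr_gt0.
have [A A0 AP] := cP _ e40; pose D := (M + `|c|) * weight A.
have w0 (y : R) : 0 <= weight y := le_trans ler01 (weight_ge1 y).
have D0 : 0 <= D by rewrite mulr_ge0 // addr_ge0 // ltW.
have hD y : 0 <= y -> `|g y - c * weight y| <= e / 4 * weight y + D.
  move=> y0; have [Ay|yA] := leP A y.
    by rewrite (le_trans (AP _ Ay)) // lerDl.
  rewrite (le_trans (ler_normB _ _)) // normrM (ger0_norm (w0 y)).
  rewrite (@le_trans _ _ ((M + `|c|) * weight y)) //.
    by rewrite mulrDl lerD2r gM.
  apply: ler_wpDl; first by rewrite mulr_ge0 // ltW.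
  apply: ler_wpM2l; first by rewrite addr_ge0 // ltW.
  by rewrite lerD2l lerXn2r ?nnegrE // ltW.
have [d d0 dP] := unif_continuous_ray (A + 1) cg e40.
pose r := Num.min d 1; have r0 : 0 < r by rewrite lt_min d0 ltr01.
(* This gives [|c| * n <= e / 4]. The remaining [3 e / 4] of [weight x] comes from
   [e / 4 * (weight u + weight x)] and [weight u <= 2 * weight x + 2 * z ^+ 2], whose square term
   accounts for the [e / 2] in the constant below. *)
pose n := e / (4 * (`|c| + 1)).
have c10 : 0 < `|c| + 1 by rewrite ltr_wpDl.
have n0 : 0 < n by rewrite divr_gt0 // mulr_gt0.
have Dr0 : 0 <= 2 * D / r ^+ 2.
  by rewrite divr_ge0 ?sqr_ge0 // mulr_ge0.
have C0 : 0 <= `|c| * (1 + n^-1) + e / 2 + 2 * D / r ^+ 2.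
  rewrite addr_ge0 // addr_ge0 //; last by rewrite divr_ge0 // ltW.
  by rewrite mulr_ge0 // addr_ge0 // invr_ge0 ltW.
exists (`|c| * (1 + n^-1) + e / 2 + 2 * D / r ^+ 2) => //.
move=> x u x0 u0; set z := u - x.
have z20 : 0 <= z ^+ 2 by exact: sqr_ge0.
have wd : `|weight u - weight x| <= n * weight x + (1 + n^-1) * z ^+ 2.
  have -> : weight u - weight x = z ^+ 2 + 2 * x * z by rewrite /weight /z; ring.
  rewrite (le_trans (ler_normD _ _)) // (ger0_norm z20) normrM ger0_norm ?mulr_ge0 //.
  (* Weighted arithmetic-geometric mean inequality for the cross term [2 x |z|]. *)
  have : 0 <= (n * x - `|z|) ^+ 2 / n by rewrite divr_ge0 ?sqr_ge0 // ltW.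
  have -> : (n * x - `|z|) ^+ 2 / n = n * x ^+ 2 - 2 * x * `|z| + n^-1 * `|z| ^+ 2.
    by field; rewrite gt_eqF.
  rewrite real_normK ?num_real // /weight; lra.
have cn : `|c| * n <= e / 4.
  have -> : `|c| * n = e / 4 * (`|c| / (`|c| + 1)) by rewrite /n; field; rewrite gt_eqF.
  by rewrite ler_piMr ?(ltW e40) // ler_pdivrMr // mul1r lerDl.
have wu : weight u <= 2 * weight x + 2 * z ^+ 2.
  have -> : 2 * weight x + 2 * z ^+ 2 = weight u + (1 + (x - z) ^+ 2).
    by rewrite /weight /z; ring.
  by rewrite lerDl addr_ge0 ?sqr_ge0.
have [xs|xs] := boolP ((x <= A + 1) && (`|z| < r)).
  have /andP[xA zr] := xs.
  rewrite (@le_trans _ _ (e / 4)) //.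
    by apply/ltW/dP; rewrite ?x0 // (lt_le_trans zr) // ge_min lexx.
  rewrite (@le_trans _ _ (e * weight x)) //.
    rewrite (@le_trans _ _ (e * 1)) //; first lra.
    by rewrite ler_wpM2l ?weight_ge1 // ltW.
  by rewrite lerDl mulr_ge0.
have hh : `|g u - c * weight u| + `|g x - c * weight x| <=
    e / 4 * (weight u + weight x) + 2 * D / r ^+ 2 * z ^+ 2.
  (* If [|z| < r <= 1], then [x > A + 1], so both [x] and [u] lie beyond [A]; this is why the
     segment was taken up to [A + 1]. *)
  have [zr|rz] := ltP `|z| r.
    move: xs; rewrite zr andbT -ltNge => xA.
    have := AP x _; have := AP u _ => /(_ _)h1 /(_ _)h2.
    have zz : `|z| < 1 by rewrite (lt_le_trans zr) // ge_min lexx orbT.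
    have Au : A <= u by move: zz; rewrite ltr_norml /z => /andP[? _]; lra.
    have Ax : A <= x by lra.
    apply: ler_wpDr; first by rewrite mulr_ge0.
    by rewrite [e / 4 * _]mulrDr lerD ?h1 ?h2.
  have : 2 * D <= 2 * D / r ^+ 2 * z ^+ 2.
    rewrite -[leRHS]mulrA; apply: ler_peMr; first by rewrite mulr_ge0.
    rewrite mulrC ler_pdivlMr ?exprn_gt0 // mul1r -[leRHS]real_normK ?num_real //.
    by rewrite lerXn2r ?nnegrE // ltW.
  have := hD _ u0; have := hD _ x0; lra.
have -> : g u - g x = c * (weight u - weight x) +
  ((g u - c * weight u) - (g x - c * weight x)) by ring.
apply: le_trans (ler_normD _ _) _; rewrite normrM.
have H := le_trans (ler_normB (g u - c * weight u) (g x - c * weight x)) hh.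
apply: le_trans (lerD (ler_wpM2l (normr_ge0 c) wd) H) _.
have := ler_wpM2r (w0 x) cn; have := ler_wpM2l (ltW e40) wu.
move: (weight u) (weight x) (z ^+ 2) (2 * D / r ^+ 2) (1 + n^-1) => p q Z E F.
have -> : `|c| * (n * q + F * Z) = `|c| * n * q + `|c| * F * Z by ring.
lra.
Qed.

(** * From a bound at the nodes to a bound on the operator *)

Lemma rl_integral_bound (R : realType) (b phi psi K y : R) (g : R -> R) i :
  0 < b -> 0 <= phi -> 0 <= psi -> {within `[0, +oo[, continuous g} ->
  (forall t, i%:R / b <= t <= i.+1%:R / b ->
    `|g ((b * t + phi) / (b + psi)) - y| <= K) ->
  `|b * (\int[lebesgue_measure]_(t in `[i%:R / b, i.+1%:R / b])
       g ((b * t + phi) / (b + psi))) - y| <= K.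
Proof.
move=> b0 phi0 psi0 cg gK; set I := `[_, _]%classic.
have bp : 0 < b + psi by rewrite ltr_wpDr.
pose v (t : R) := (b * t + phi) / (b + psi).
have cpt : compact I by exact: segment_compact.
have mI : measurable (I : set (measurableTypeR R)) by exact: measurable_itv.
have cgv : {within I, continuous (g \o v)}.
  have v0 t : I t -> 0 <= v t.
    rewrite /I /= in_itv /= => /andP[it _].
    have t0 : 0 <= t by rewrite (le_trans _ it) // divr_ge0 // ltW.
    by rewrite divr_ge0 ?(ltW bp) // addr_ge0 // mulr_ge0 // ltW.
  have cv : continuous v.
    move=> t; apply: cvgM; last exact: cvg_cst.
    apply: cvgD; last exact: cvg_cst.
    by apply: cvgM; [exact: cvg_cst|exact: cvg_id].
  move/subspace_continuousP in cg; apply/subspace_continuousP => t It.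
  have vt : `[0, +oo[%classic (v t) by rewrite /= in_itv /= v0.
  apply: (cvg_comp v g) (cg _ vt) => U /= hU.
  apply: (@filterS _ (nbhs t) _ _ _ _ (cv t _ hU)) => z /= + Iz.
  by apply; rewrite in_itv /= v0.
have ig : lebesgue_measure.-integrable I (EFin \o (g \o v)).
  exact: continuous_compact_integrable.
have ic (k : R) : lebesgue_measure.-integrable I (EFin \o cst k).
  apply: continuous_compact_integrable => //.
  by apply: continuous_subspaceT => z; exact: cst_continuous.
have mu : fine (lebesgue_measure I) = b^-1.
  rewrite /I lebesgue_measure_itv /= lte_fin ltr_pM2r ?invr_gt0 // ltr_nat leqnn /=.
  by rewrite -mulrBl -natr1 addrAC subrr add0r mul1r.
(* As [I] has length [1 / b], [b] times the integral is an average, so the constant [y] can be moved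
   under it. *)
have -> : b * (\int[lebesgue_measure]_(t in I) g ((b * t + phi) / (b + psi))) - y =
    b * \int[lebesgue_measure]_(t in I) ((g \o v) t - y).
  rewrite (RintegralB mI ig (ic y)) (Rintegral_cst _ mI) // mu.
  by rewrite /v /=; field; rewrite gt_eqF.
rewrite normrM gtr0_norm // -ler_pdivlMl // mulrC -mu -Rintegral_cst //.
have igy : lebesgue_measure.-integrable I (EFin \o (fun t => (g \o v) t - y)).
  apply: continuous_compact_integrable => // z.
  by apply: cvgB; [exact: cgv|exact: cvg_cst].
apply: le_trans (le_normr_Rintegral _ _) _ => //.
by apply: le_Rintegral => //; [exact: integrable_norm|exact: ic].
Qed.

(** Since the weights sum to 1, [RL g x - g x] is the weighted sum of the deviations of the local
    averages from [g x]. These are dominated termwise by a series that [rl_weight_quad] sums. *)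
Lemma RL_bound (R : realType) (b a phi psi x A B : R) (g : R -> R) :
  0 < b -> 0 <= a -> 0 <= phi -> 0 <= psi -> 0 <= x ->
  {within `[0, +oo[, continuous g} ->
  (forall (i : nat) t, i%:R / b <= t <= i.+1%:R / b ->
    `|g ((b * t + phi) / (b + psi)) - g x| <= A + B * (i%:R / b - x) ^+ 2) ->
  `|RL b a phi psi g x - g x| <= A + B * (x * a + x / b).
Proof.
move=> b0 a0 phi0 psi0 x0 cg gK; set y := g x.
have bn0 : b != 0 by rewrite gt_eqF.
pose W := rl_weight b a x; pose T := rl_term b a phi psi g x.
pose K i : R := (A + B * (i%:R / b - x) ^+ 2) * W i.
pose D i : R := b * T i - y * W i.
have W0 i : 0 <= W i := rl_weight_ge0 i b0 a0 x0.
have DK i : `|D i| <= K i.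
  rewrite /D /T /rl_term -/(rcoef a x i) -/(rl_weight b a x i) -/(W i).
  rewrite mulrCA [y * _]mulrC -mulrBr normrM ger0_norm // mulrC ler_wpM2r //.
  by apply: rl_integral_bound => // t /gK.
have K0 i : 0 <= K i := le_trans (normr_ge0 _) (DK i).
have cK : series K @ \oo --> A + B * (x * a + x / b) by exact: rl_weight_quad.
have cnD : cvgn [normed series D].
  by apply: (@series_le_cvg _ _ K) => [i|//|//|]; [exact: normr_ge0|exact: cvgP cK].
have cD := normed_cvg cnD.
(* [RL] is defined through [limn], so convergence of its series must be established: it is recovered
   from that of [D], which converges absolutely, and of the weights. *)
have -> : RL b a phi psi g x = limn (series D) + y.
  rewrite /RL -/T.
  suff cT : series T @ \oo --> b^-1 * (limn (series D) + y * 1).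
    by rewrite (cvg_lim _ cT) // mulr1 mulVKf.
  have -> : series T = fun n => b^-1 * (series D n + y * series W n).
    apply/funext => n; rewrite /series /= !mulr_sumr -big_split /= mulr_sumr.
    by apply: eq_bigr => i _; rewrite /D subrK mulKf.
  apply: cvgM; first exact: cvg_cst.
  apply: cvgD cD _; apply: cvgM; first exact: cvg_cst.
  exact: rl_weight_cvg.
rewrite addrK -(cvg_lim _ cK) //.
apply: le_trans (lim_series_norm cnD) _.
by apply: lim_series_le => //; exact: cvgP cK.
Qed.

(** * Uniform estimate and convergence in the weighted norm *)

Lemma cvge0_near (R : realType) (u : nat -> \bar R) :
  (forall n, (0 <= u n)%E) ->
  (forall e : R, 0 < e -> \forall n \near \oo, (u n <= e%:E)%E) ->
  u n @[n --> \oo] --> 0%E.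
Proof.
move=> u0 uP; apply/fine_cvgP; split.
  near=> n; rewrite ge0_fin_numE // (@le_lt_trans _ _ 1%:E) ?ltry //.
  by near: n; exact: uP.
apply/cvgrPdist_le => e e0; near=> n.
rewrite sub0r normrN ger0_norm ?fine_ge0 // -lee_fin.
have ue : (u n <= e%:E)%E by near: n; exact: uP.
by rewrite fineK // ge0_fin_numE // (le_lt_trans ue) // ltry.
Unshelve. all: by end_near. Qed.

Lemma wnorm_ge0 (R : realType) (f : R -> R) : (0 <= wnorm f)%E.
Proof.
apply: (@le_trans _ _ (`|f 0| / weight 0)%:E).
  by rewrite lee_fin divr_ge0 // (le_trans ler01) // weight_ge1.
by apply: ereal_sup_ubound; exists 0 => //=; rewrite in_itv /= lexx.
Qed.

(** For the node [u], [(b + psi) (u - x)] is [i - b x] plus an error of size at most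
    [E = 1 + phi + psi x], as [b t - i] lies in [[0, 1]]. Squaring with [(p + q)^2 <= 2 p^2 + 2 q^2]
    and bounding [E ^+ 2] by a multiple of [weight x] gives the claim. *)
Lemma rl_node_dist (R : realType) (b phi psi x t : R) (i : nat) :
  0 < b -> 0 <= phi -> 0 <= psi -> 0 <= x ->
  i%:R / b <= t <= i.+1%:R / b ->
  ((b * t + phi) / (b + psi) - x) ^+ 2 <=
    2 * (i%:R / b - x) ^+ 2 +
    2 * ((2 * (1 + phi) ^+ 2 + 2 * psi ^+ 2) / b ^+ 2) * weight x.
Proof.
move=> b0 phi0 psi0 x0; have bp : 0 < b + psi by rewrite ltr_wpDr.
move=> /andP[it ti].
have bt : i%:R <= b * t by rewrite mulrC -ler_pdivrMr.
have bt1 : b * t <= i%:R + 1 by rewrite natr1 mulrC -ler_pdivlMr.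
set u := (b * t + phi) / (b + psi); pose E := 1 + phi + psi * x.
have px : 0 <= psi * x by rewrite mulr_ge0.
have E0 : 0 <= E by rewrite /E; lra.
have h : b * `|u - x| <= `|i%:R - b * x| + E.
  rewrite (@le_trans _ _ ((b + psi) * `|u - x|)) //.
    by rewrite ler_wpM2r // lerDl.
  rewrite -[X in X * `|_|]gtr0_norm // -normrM.
  have -> : (b + psi) * (u - x) = (i%:R - b * x) + (b * t - i%:R + phi - psi * x).
    by rewrite /u; field; rewrite gt_eqF.
  rewrite (le_trans (ler_normD _ _)) // lerD2l ler_norml /E.
  by apply/andP; split; lra.
have h2 : (b * (u - x)) ^+ 2 <= 2 * (i%:R - b * x) ^+ 2 + 2 * E ^+ 2.
  rewrite -[leLHS]real_normK ?num_real // normrM gtr0_norm //.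
  apply: (@le_trans _ _ ((`|i%:R - b * x| + E) ^+ 2)).
    by rewrite lerXn2r ?nnegrE ?addr_ge0 ?mulr_ge0 // ltW.
  rewrite -[X in _ <= 2 * X + _]real_normK ?num_real //.
  have -> : 2 * `|i%:R - b * x| ^+ 2 + 2 * E ^+ 2 =
    (`|i%:R - b * x| + E) ^+ 2 + (`|i%:R - b * x| - E) ^+ 2 by ring.
  by rewrite lerDl sqr_ge0.
have h3 : E ^+ 2 <= (2 * (1 + phi) ^+ 2 + 2 * psi ^+ 2) * weight x.
  have -> : (2 * (1 + phi) ^+ 2 + 2 * psi ^+ 2) * weight x = E ^+ 2 +
    ((1 + phi - psi * x) ^+ 2 + 2 * ((1 + phi) * x) ^+ 2 + 2 * psi ^+ 2).
    by rewrite /weight /E; ring.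
  by rewrite lerDl addr_ge0 ?addr_ge0 ?sqr_ge0 // mulr_ge0 // sqr_ge0.
rewrite -(@ler_pM2l _ (b ^+ 2)) ?exprn_gt0 // -exprMn (le_trans h2) //.
rewrite (_ : b ^+ 2 * _ = 2 * (i%:R - b * x) ^+ 2 +
  2 * ((2 * (1 + phi) ^+ 2 + 2 * psi ^+ 2) * weight x)); last first.
  by field; rewrite gt_eqF.
by rewrite lerD2l ler_wpM2l.
Qed.

Theorem theorem5p1 (R : realType) (beta alpha : nat -> R) (phi psi : R)
  (beta_incr : forall m n : nat, (1 <= m)%N -> (m < n)%N -> beta m < beta n)
  (beta1 : beta 1%N = 1)
  (beta_pinfty : beta n @[n --> \oo] --> +oo)
  (phi_ge0 : 0 <= phi) (phi_le_psi : phi <= psi)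
  (alpha_ge0 : forall n : nat, (1 <= n)%N -> 0 <= alpha n)
  (alpha_to0 : alpha n @[n --> \oo] --> (0 : R))
  (g : R -> R) (g_Cwk : Cwk g) :
  wnorm (fun x => RL (beta n) (alpha n) phi psi g x - g x) @[n --> \oo]
    --> 0%E.
Proof.
have psi0 : 0 <= psi := le_trans phi_ge0 phi_le_psi.
apply: cvge0_near => [n|e e0]; first exact: wnorm_ge0.
have e20 : 0 < e / 2 by rewrite divr_gt0.
have [C C0 gC] := Cwk_modulus g_Cwk e20.
have cg : {within `[0, +oo[, continuous g} by case: g_Cwk => -[].
pose E := 2 * (1 + phi) ^+ 2 + 2 * psi ^+ 2.
have E0 : 0 <= E by rewrite addr_ge0 // mulr_ge0 // sqr_ge0.
(* Chosen so that [2 C (d + d) = e / 2 * (C / (C + 1)) <= e / 2]; the added 1 keeps the denominator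
   positive when [C = 0]. *)
pose d := e / (8 * (C + 1)).
have C10 : 0 < C + 1 by rewrite ltr_wpDl.
have d0 : 0 < d by rewrite divr_gt0 // mulr_gt0.
near=> n.
have n1 : (1 <= n)%N by near: n; exists 1%N.
have a0 := alpha_ge0 n n1.
have b1 : 1 <= beta n by near: n; move/cvgryPge: beta_pinfty; apply.
(* Together with [beta n >= 1] this makes [E / b ^+ 2 + 1 / b <= (1 + E) / b <= d]. *)
have bE : (1 + E) / d <= beta n by near: n; move/cvgryPge: beta_pinfty; apply.
have ad : alpha n <= d.
  rewrite -[leLHS]ger0_norm // -normrN -sub0r.
  by near: n; move/cvgrPdist_le: alpha_to0; apply.
move: (alpha n) (beta n) a0 b1 bE ad => a b a0 b1 bE ad.
have b0 : 0 < b := lt_le_trans ltr01 b1.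
apply: ge_ereal_sup => _ [x /= + <-]; rewrite in_itv /= andbT => x0.
have wx := weight_ge1 x; have w0 : 0 < weight x := lt_le_trans ltr01 wx.
rewrite lee_fin ler_pdivrMr //.
(* The modulus of [g] is evaluated at the node, and [rl_node_dist] splits [C * (u - x) ^+ 2] into a
   part independent of [i] and [2 C] times the squared deviation of [i / b]. *)
apply: le_trans (@RL_bound _ b a phi psi x
  (e / 2 * weight x + 2 * C * (E / b ^+ 2) * weight x) (2 * C) g _ _ _ _ _ _ _) _ => //.
  move=> i t it; have bt0 : 0 <= (b * t + phi) / (b + psi).
    have /andP[h _] := it.
    have t0 : 0 <= t by rewrite (le_trans _ h) // divr_ge0 // ltW.
    by rewrite divr_ge0 ?addr_ge0 ?mulr_ge0 // ltW.
  apply: le_trans (gC _ _ x0 bt0) _; rewrite -addrA lerD2l.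
  apply: le_trans (ler_wpM2l C0 (rl_node_dist b0 phi_ge0 psi0 x0 it)) _.
  by rewrite -/E le_eqVlt; apply/orP; left; apply/eqP; ring.
have xw : x <= weight x.
  by have := sqr_ge0 (x - 1); have := sqr_ge0 x; rewrite sqrrB /weight; lra.
have bi : b^-1 <= 1 by rewrite invf_le1.
have bi0 : 0 <= b^-1 by rewrite invr_ge0 ltW.
have bb : E / b ^+ 2 + b^-1 <= d.
  rewrite (@le_trans _ _ ((1 + E) / b)) //; last by rewrite ler_pdivrMr // mulrC -ler_pdivrMr.
  rewrite [(1 + E) / b]mulrDl mul1r addrC lerD2l ler_wpM2l // expr2 invfM.
  by rewrite ler_piMr.
have dC : 2 * C * (d + d) <= e / 2.
  have -> : 2 * C * (d + d) = e / 2 * (C / (C + 1)) by rewrite /d; field; rewrite gt_eqF.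
  by rewrite ler_piMr ?(ltW e20) // ler_pdivrMr // mul1r lerDl.
have xab : x * a + x / b <= weight x * (a + b^-1).
  by rewrite -mulrDr ler_wpM2r // addr_ge0.
have C20 : 0 <= 2 * C by rewrite mulr_ge0.
apply: le_trans (lerD (lexx _) (ler_wpM2l C20 xab)) _.
have -> : e / 2 * weight x + 2 * C * (E / b ^+ 2) * weight x +
    2 * C * (weight x * (a + b^-1)) =
  (e / 2 + 2 * C * (a + (E / b ^+ 2 + b^-1))) * weight x by ring.
apply: ler_wpM2r; first exact: ltW.
rewrite [leRHS]splitr lerD2l; apply: le_trans dC.
by apply: ler_wpM2l => //; exact: lerD.
Unshelve. all: by end_near. Qed.
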